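(* Let $P$ and $U$ be monic elements of $\mathcal{G}$ with associated polynomial sequences $\{p_k(t)\}_{k\ge 0}$ and $\{u_k(t)\}_{k\ge 0}$ respectively. Define $H = P X P^{-1}$ and $K = U X U^{-1}$, and let $$e(n,m,k) = \sum_{j=0}^{n+m} p_n(H)_{m,j}\; p_j(K)_{0,k}, \qquad n,m,k\in\mathbb{N}.$$ Then for every $m\ge 0$, $$p_m(t) = \sum_{k=0}^{m} e(0,m,k)\, u_k(t) = \sum_{k=0}^{m} p_m(K)_{0,k}\, u_k(t).$$
   Context: $\mathbb{N}$ denotes the non-negative integers. All matrices are infinite, with complex entries and rows and columns indexed by $\mathbb{N}$. $\mathcal{L}$ is the set of matrices $A=[a_{j,k}]$ for which there is an integer $m$ such that $a_{j,k}=0$ whenever $j-k<m$ (lower generalized Hessenberg matrices); it is closed under addition, scalar multiplication and matrix multiplication (all sums in products are finite). $\mathcal{G}$ is the group, under matrix multiplication, of the lower triangular matrices ($a_{j,k}=0$ for $j<k$) with $a_{k,k}\neq 0$ for all $k\ge 0$; its unit is the identity matrix $I$. An element of $\mathcal{G}$ is monic if all its entries on the main diagonal are equal to $1$. $X$ is the matrix with $X_{j,j+1}=1$ for $j\ge 0$ and all other entries zero. The polynomial sequence associated with $P\in\mathcal{G}$ is $p_k(t)=\sum_{j=0}^{k} P_{k,j}\,t^j$, $k\ge 0$; likewise $u_k(t)=\sum_{j=0}^{k}U_{k,j}t^j$ for $U$. For a polynomial $w(t)=\sum_i w_i t^i$ and a matrix $M\in\mathcal{L}$, $w(M)=\sum_i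 w_i M^i$ with $M^0=I$. *)

(* Defs.v *)
From HB Require Import structures.
From mathcomp Require Import all_boot all_order all_algebra.
From mathcomp Require Export complex.
From mathcomp Require Import zify.
From mathcomp Require Import boolp classical_sets functions fsbigop.
From mathcomp Require Export reals.

Set Implicit Arguments.
Unset Strict Implicit.
Unset Printing Implicit Defensive.

Import Order.TTheory GRing.Theory Num.Theory.
Local Open Scope classical_set_scope.
Local Open Scope ring_scope.

(* The algebra L of lower generalized Hessenberg matrices: infinite matrices   *)
(* whose entries vanish when [j - k < m], for some integer [m] that may be     *)
(* negative (the subtraction is in [int]).                                     *)

Record hessenberg (F : fieldType) := Hessenberg {
  hess_entry :> nat -> nat -> F;
  hess_band : exists m : int,
    forall j k : nat, j%:Z - k%:Z < m -> hess_entry j k = 0 }.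

HB.instance Definition _ (F : fieldType) := gen_eqMixin (hessenberg F).
HB.instance Definition _ (F : fieldType) := gen_choiceMixin (hessenberg F).

Section HessenbergAlgebra.
Variable F : fieldType.
Implicit Types (A B C : hessenberg F) (a b : F).

Lemma hessP A B : (forall j k, A j k = B j k) -> A = B.
Proof.
case: A => A hA; case: B => B hB /= eqAB.
have E : A = B by apply/funext => j; apply/funext => k.
by case: _ / E hB => hB; congr Hessenberg; apply: Prop_irrelevance.
Qed.

Lemma hess_rowb A n :
  exists N : nat, forall j i, (j <= n)%N -> (N <= i)%N -> A j i = 0.
Proof.
have [m Am] := hess_band A.
exists (n + `|m|%N).+1 => j i jn Ni; apply: Am; lia.
Qed.

Fact add_band A B : exists m : int,
  forall j k : nat, j%:Z - k%:Z < m -> A j k + B j k = 0.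
Proof.
have [m Am] := hess_band A; have [p Bp] := hess_band B.
exists (Num.min m p) => j k; rewrite lt_min => /andP[/Am -> /Bp ->].
by rewrite addr0.
Qed.

Fact opp_band A : exists m : int,
  forall j k : nat, j%:Z - k%:Z < m -> - A j k = 0.
Proof.
by have [m Am] := hess_band A; exists m => j k /Am ->; rewrite oppr0.
Qed.

Fact scale_band a A : exists m : int,
  forall j k : nat, j%:Z - k%:Z < m -> a * A j k = 0.
Proof.
by have [m Am] := hess_band A; exists m => j k /Am ->; rewrite mulr0.
Qed.

Fact zero_band : exists m : int,
  forall j k : nat, j%:Z - k%:Z < m -> 0 = 0 :> F.
Proof. by exists 0. Qed.

Fact one_band : exists m : int,
  forall j k : nat, j%:Z - k%:Z < m -> (j == k)%:R = 0 :> F.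
Proof.
by exists 0 => j k jk; case: eqP jk => // ->; rewrite subrr ltxx.
Qed.

(* The sum ranges over all of nat; in an fsbig only the nonzero terms count,   *)
(* and there are finitely many of them (see [hess_mulE]).                      *)
Fact mul_band A B : exists m : int,
  forall j k : nat, j%:Z - k%:Z < m ->
    \sum_(i \in [set: nat]) A j i * B i k = 0.
Proof.
have [m Am] := hess_band A; have [p Bp] := hess_band B.
exists (m + p) => j k jk; apply: fsbig1 => i _.
have [ji|ji] := ltP (j%:Z - i%:Z) m; first by rewrite Am ?mul0r.
rewrite Bp ?mulr0 //; lia.
Qed.

Definition hess_zero : hessenberg F := Hessenberg zero_band.
Definition hess_one : hessenberg F := Hessenberg one_band.
Definition hess_add A B : hessenberg F := Hessenberg (add_band A B).
Definition hess_opp A : hessenberg F := Hessenberg (opp_band A).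
Definition hess_scale a A : hessenberg F := Hessenberg (scale_band a A).
Definition hess_mul A B : hessenberg F := Hessenberg (mul_band A B).

Fact hess_addA : associative hess_add.
Proof. by move=> A B C; apply: hessP => j k /=; rewrite addrA. Qed.
Fact hess_addC : commutative hess_add.
Proof. by move=> A B; apply: hessP => j k /=; rewrite addrC. Qed.
Fact hess_add0 : left_id hess_zero hess_add.
Proof. by move=> A; apply: hessP => j k /=; rewrite add0r. Qed.
Fact hess_addN : left_inverse hess_zero hess_opp hess_add.
Proof. by move=> A; apply: hessP => j k /=; rewrite addNr. Qed.

HB.instance Definition _ := GRing.isZmodule.Build (hessenberg F)
  hess_addA hess_addC hess_add0 hess_addN.

Lemma hess_addE A B j k : (A + B) j k = A j k + B j k.
Proof. by []. Qed.

Lemma hess_mulE A B j k N : (forall i, (N <= i)%N -> A j i = 0) ->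
  hess_mul A B j k = \sum_(i < N) A j i * B i k.
Proof.
move=> AN /=; rewrite (fsbig_ord _ _ (fun i => A j i * B i k)).
apply/esym/fsbig_widen => // i [_ /= /negP]; rewrite -leqNgt => Ni.
by rewrite AN ?mul0r.
Qed.

Fact hess_mulA : associative hess_mul.
Proof.
move=> A B C; apply: hessP => j k.
have [N AN] := hess_rowb A j; have [M BM] := hess_rowb B N.
have ABE l : hess_mul A B j l = \sum_(i < N) A j i * B i l.
  by apply: hess_mulE => i; apply: AN.
rewrite (hess_mulE _ _ (N := N)); last by move=> i; apply: AN.
rewrite (hess_mulE _ _ (N := M)); last first.
  move=> l Ml; rewrite ABE big1 // => i _.
  by rewrite (BM i l (ltnW (ltn_ord i)) Ml) mulr0.
under eq_bigr => i _.
  rewrite (hess_mulE _ _ (N := M)); last first.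
    by move=> l; apply: BM; exact/ltnW/ltn_ord.
  rewrite mulr_sumr.
  over.
rewrite exchange_big; apply: eq_bigr => l _; rewrite ABE mulr_suml.
by apply: eq_bigr => i _; rewrite mulrA.
Qed.

Fact hess_mul1l : left_id hess_one hess_mul.
Proof.
move=> A; apply: hessP => j k; rewrite (hess_mulE _ _ (N := j.+1)).
  rewrite (bigD1 ord_max) //= eqxx mul1r big1 ?addr0 // => i.
  by rewrite -val_eqE /= eq_sym => /negbTE ->; rewrite mul0r.
by move=> i ji /=; rewrite ltn_eqF.
Qed.

Fact hess_mul1r : right_id hess_one hess_mul.
Proof.
move=> A; apply: hessP => j k.
have [N AN] := hess_rowb A j.
rewrite (hess_mulE _ _ (N := (N + k).+1)); last first.
  by move=> i Ni; apply: AN => //; lia.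
have kN : (k < (N + k).+1)%N by lia.
rewrite (bigD1 (Ordinal kN)) //= eqxx mulr1 big1 ?addr0 // => i.
by rewrite -val_eqE /= => /negbTE ->; rewrite mulr0.
Qed.

Fact hess_mulDl : left_distributive hess_mul +%R.
Proof.
move=> A B C; apply: hessP => j k.
have [N AN] := hess_rowb A j; have [M BM] := hess_rowb B j.
have [A0 B0] : (forall i, (N + M <= i)%N -> A j i = 0) /\
               (forall i, (N + M <= i)%N -> B j i = 0).
  by split=> i NMi; [apply: AN | apply: BM] => //; lia.
rewrite hess_addE.
rewrite !(hess_mulE _ _ (N := N + M)) //.
  by rewrite -big_split; apply: eq_bigr => i _; rewrite /= mulrDl.
by move=> i NMi /=; rewrite A0 ?B0 ?addr0.
Qed.

Fact hess_mulDr : right_distributive hess_mul +%R.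
Proof.
move=> A B C; apply: hessP => j k.
have [N AN] := hess_rowb A j.
have A0 i : (N <= i)%N -> A j i = 0 by apply: AN.
rewrite hess_addE.
rewrite !(hess_mulE _ _ (N := N)) // -big_split.
by apply: eq_bigr => i _; rewrite /= mulrDr.
Qed.

Fact hess_oner_neq0 : hess_one != 0.
Proof.
by apply/eqP => /(congr1 (fun A => hess_entry A 0 0))/eqP; rewrite /= oner_eq0.
Qed.

HB.instance Definition _ := GRing.Zmodule_isNzRing.Build (hessenberg F)
  hess_mulA hess_mul1l hess_mul1r hess_mulDl hess_mulDr hess_oner_neq0.

Fact hess_scaleA a b A : hess_scale a (hess_scale b A) = hess_scale (a * b) A.
Proof. by apply: hessP => j k /=; rewrite mulrA. Qed.
Fact hess_scale1 : left_id 1 hess_scale.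
Proof. by move=> A; apply: hessP => j k /=; rewrite mul1r. Qed.
Fact hess_scaleDr : right_distributive hess_scale +%R.
Proof. by move=> a A B; apply: hessP => j k /=; rewrite mulrDr. Qed.
Fact hess_scaleDl A : {morph hess_scale^~ A : a b / a + b}.
Proof. by move=> a b; apply: hessP => j k /=; rewrite mulrDl. Qed.

HB.instance Definition _ := GRing.Zmodule_isLmodule.Build F (hessenberg F)
  hess_scaleA hess_scale1 hess_scaleDr hess_scaleDl.

Lemma hess_scaleE a A j k : (a *: A) j k = a * A j k.
Proof. by []. Qed.

Fact hess_scaleAl a A B : a *: (A * B) = (a *: A) * B.
Proof.
apply: hessP => j k; have [N AN] := hess_rowb A j.
have A0 i : (N <= i)%N -> A j i = 0 by apply: AN.
have aA0 i : (N <= i)%N -> (a *: A) j i = 0 by move=> /A0 /= ->; rewrite mulr0.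
rewrite hess_scaleE !(hess_mulE _ _ (N := N)) // mulr_sumr.
by apply: eq_bigr => i _; rewrite /= mulrA.
Qed.

Fact hess_scaleAr a A B : a *: (A * B) = A * (a *: B).
Proof.
apply: hessP => j k; have [N AN] := hess_rowb A j.
have A0 i : (N <= i)%N -> A j i = 0 by apply: AN.
rewrite hess_scaleE !(hess_mulE _ _ (N := N)) // mulr_sumr.
by apply: eq_bigr => i _; rewrite /= mulrCA.
Qed.

HB.instance Definition _ :=
  GRing.Lmodule_isLalgebra.Build F (hessenberg F) hess_scaleAl.
HB.instance Definition _ :=
  GRing.Lalgebra_isAlgebra.Build F (hessenberg F) hess_scaleAr.

Definition hess_unit : pred (hessenberg F) :=
  fun A => `[< exists B, B * A = 1 /\ A * B = 1 >].

Definition hess_inv A : hessenberg F :=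
  xget A [set B | B * A = 1 /\ A * B = 1].

Fact hess_invP A : hess_unit A -> hess_inv A * A = 1 /\ A * hess_inv A = 1.
Proof.
move=> /asboolP[B BA]; rewrite /hess_inv.
exact: (@xgetPex _ A [set B | B * A = 1 /\ A * B = 1] (ex_intro _ B BA)).
Qed.

Fact hess_mulVr : {in hess_unit, left_inverse 1 hess_inv *%R}.
Proof. by move=> A /hess_invP[]. Qed.
Fact hess_mulrV : {in hess_unit, right_inverse 1 hess_inv *%R}.
Proof. by move=> A /hess_invP[]. Qed.
Fact hess_unitP A B : B * A = 1 /\ A * B = 1 -> hess_unit A.
Proof. by move=> BA; apply/asboolP; exists B. Qed.
Fact hess_inv_out : {in [predC hess_unit], hess_inv =1 id}.
Proof.
move=> A /negP uA; rewrite /hess_inv.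
by case: xgetP => // B _ BA; case: uA; apply: hess_unitP BA.
Qed.

HB.instance Definition _ := GRing.NzRing_hasMulInverse.Build (hessenberg F)
  hess_mulVr hess_mulrV hess_unitP hess_inv_out.

Fact shift_band : exists m : int,
  forall j k : nat, j%:Z - k%:Z < m -> (k == j.+1)%:R = 0 :> F.
Proof.
by exists (- 1) => j k jk; case: eqP jk => // ->; rewrite -natz; lia.
Qed.

End HessenbergAlgebra.

Definition shiftX (F : fieldType) : hessenberg F := Hessenberg (shift_band F).

Definition calG (F : fieldType) (P : hessenberg F) : Prop :=
  (forall j k : nat, (j < k)%N -> P j k = 0) /\ (forall k : nat, P k k != 0).

Definition monic_calG (F : fieldType) (P : hessenberg F) : Prop :=
  calG P /\ (forall k : nat, P k k = 1).

Definition assoc_poly (F : fieldType) (P : hessenberg F) (k : nat) : {poly F} :=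
  \poly_(j < k.+1) P k j.

(* The inverse in the algebra L of an element of G is its inverse in the       *)
(* group G.                                                                    *)
Section GroupG.
Variable F : fieldType.
Implicit Types (P Q : hessenberg F).

Lemma calG_mulE P Q j k : (forall j k : nat, (j < k)%N -> P j k = 0) ->
  (P * Q) j k = \sum_(i < j.+1) P j i * Q i k.
Proof. by move=> P0; apply: hess_mulE => i ji; apply: P0. Qed.

Lemma calG1 : calG (1 : hessenberg F).
Proof.
split=> [j k jk|k] /=; first by rewrite ltn_eqF.
by rewrite eqxx oner_neq0.
Qed.

Lemma calGM P Q : calG P -> calG Q -> calG (P * Q).
Proof.
move=> [P0 P1] [Q0 Q1]; split=> [j k jk|k]; rewrite calG_mulE //.
  by apply: big1 => i _; rewrite Q0 ?mulr0 //; apply: leq_trans jk; apply: ltn_ord.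
rewrite big_ord_recr /= big1 ?add0r ?mulf_neq0 // => i _.
by rewrite Q0 ?mulr0.
Qed.

Fixpoint fsubst (A : nat -> nat -> F) (n j k : nat) : F :=
  if n isn't n'.+1 then 0 else
  if j != n' then fsubst A n' j k else
  ((j == k)%:R - \sum_(i < n') A j i * fsubst A n' i k) / A j j.

Lemma fsubst_stable A n j k : (j < n)%N -> fsubst A n j k = fsubst A j.+1 j k.
Proof.
elim: n => // n IHn; rewrite ltnS leq_eqVlt => /orP[/eqP -> //|jn].
by rewrite -(IHn jn) [LHS]/= ltn_eqF.
Qed.

Lemma fsubstE A j k : fsubst A j.+1 j k =
  ((j == k)%:R - \sum_(i < j) A j i * fsubst A i.+1 i k) / A j j.
Proof.
rewrite /= eqxx /=; congr ((_ - _) / _); apply: eq_bigr => i _.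
by rewrite (fsubst_stable _ _ (ltn_ord i)).
Qed.

Lemma fsubst_lower A j k : (j < k)%N -> fsubst A j.+1 j k = 0.
Proof.
elim/ltn_ind: j => j IHj jk; rewrite fsubstE ltn_eqF // big1 ?subrr ?mul0r //.
by move=> i _; rewrite IHj ?mulr0 //; apply: ltn_trans jk.
Qed.

Lemma calG_rinv P : calG P -> exists2 Q, calG Q & P * Q = 1.
Proof.
move=> [P0 P1].
have Qband : exists m : int, forall j k : nat, j%:Z - k%:Z < m ->
    fsubst P j.+1 j k = 0.
  by exists 0 => j k jk; apply: fsubst_lower; lia.
pose Q := Hessenberg Qband.
have QE j k : Q j k = fsubst P j.+1 j k by [].
exists Q.
  split=> [j k|k]; rewrite QE; first exact: fsubst_lower.
  rewrite fsubstE eqxx big1 ?subr0 ?mul1r ?invr_eq0 // => i _.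
  by rewrite fsubst_lower ?mulr0.
apply: hessP => j k; rewrite calG_mulE // big_ord_recr QE fsubstE.
by rewrite [P j _ * _]mulrC divfK // [LHS]addrC; apply: subrK.
Qed.

Lemma calG_unitV P : calG P -> P \is a GRing.unit /\ calG P^-1.
Proof.
move=> GP; have [Q GQ PQ] := calG_rinv GP; have [R _ QR] := calG_rinv GQ.
have QP : Q * P = 1 by rewrite -[P]mulr1 -QR (mulrA P) PQ mul1r.
have uP : P \is a GRing.unit by apply/unitrP; exists Q.
by split=> //; rewrite -[P^-1]mulr1 -PQ mulKr.
Qed.

End GroupG.

(* Main.v *)
(* Since p_m(K) = U p_m(X) U^-1, and since row 0 of U is that of the identity
   while row 0 of w(X) lists the coefficients of w, row 0 of p_m(K) is row m of
   P U^-1: these are the coordinates of p_m in the basis (u_k). *)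
Require Import Defs.
From mathcomp Require Import all_boot all_order all_algebra.

Import GRing.Theory.
Local Open Scope ring_scope.

(** Conjugation by a unit is an algebra morphism; in the Horner recursion the inner factors
    [U^-1 * U] cancel. *)
Lemma horner_alg_conj (F : fieldType) (U A : hessenberg F) (w : {poly F}) :
  U \is a GRing.unit ->
  horner_alg (U * A * U^-1) w = U * horner_alg A w * U^-1.
Proof.
move=> uU; elim/poly_ind: w => [|w c IHw]; first by rewrite !rmorph0 mulr0 mul0r.
rewrite !rmorphD !rmorphM /= !horner_algX !horner_algC IHw mulrDr mulrDl.
by rewrite -scalerAr -scalerAl mulr1 divrr // !mulrA mulrVK.
Qed.

(** If a row is read as a list of coefficients, this is multiplication by $t$, the counterpart of
    [coefMX]. *)
Lemma hess_mulXE (F : fieldType) (A : hessenberg F) (j k : nat) :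
  (A * shiftX F) j k = if k is k'.+1 then A j k' else 0.
Proof.
have [N AN] := hess_rowb A j.
(* The bound [N + k] covers the support of row [j] and, when [k > 0], also the index [k - 1], the
   only one that contributes. *)
rewrite [LHS](@hess_mulE _ _ _ _ _ (N + k)); last first.
  by move=> i Ni; apply: AN => //; apply: leq_trans Ni; apply: leq_addr.
case: k => [|k]; first by apply: big1 => i _; rewrite /= mulr0.
have kN : (k < N + k.+1)%N by rewrite addnS ltnS leq_addl.
rewrite (bigD1 (Ordinal kN)) //= eqxx mulr1 big1 ?addr0 // => i.
by rewrite -val_eqE /= eqSS eq_sym => /negbTE ->; rewrite mulr0.
Qed.

Lemma horner_alg_shiftX_row0 (F : fieldType) (w : {poly F}) (k : nat) :
  horner_alg (shiftX F) w 0%N k = w`_k.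
Proof.
elim/poly_ind: w k => [|w c IHw] k; first by rewrite rmorph0 coef0.
have -> : horner_alg (shiftX F) (w * 'X + c%:P) =
          horner_alg (shiftX F) w * shiftX F + c%:A.
  by rewrite rmorphD rmorphM /= horner_algX horner_algC.
rewrite hess_addE hess_scaleE hess_mulXE coefD coefMX coefC.
by case: k => [|k] /=; rewrite ?mulr1 ?mulr0 ?IHw.
Qed.

Lemma horner_alg_conjX_row0 (F : fieldType) (P U : hessenberg F) (m k : nat) :
  calG P -> monic_calG U ->
  horner_alg (U * shiftX F * U^-1) (assoc_poly P m) 0%N k = (P * U^-1) m k.
Proof.
move=> [P0 _] [GU U1]; have [uU _] := calG_unitV GU; have [U0 _] := GU.
(* By triangularity, row 0 of [U] reduces to its diagonal entry 1. *)
rewrite horner_alg_conj // -mulrA !calG_mulE // big_ord1 U1 mul1r.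
(* A polynomial in $X$ is upper triangular; here the sum is cut at [m.+1] because $p_m$ has degree
   at most $m$. *)
rewrite [LHS](@hess_mulE _ _ _ _ _ m.+1) => [|i mi]; last first.
  by rewrite horner_alg_shiftX_row0 coef_poly ltnNge mi.
apply: eq_bigr => i _.
by rewrite horner_alg_shiftX_row0 coef_poly ltn_ord.
Qed.

Lemma assoc_polyM (F : fieldType) (Q U : hessenberg F) (m : nat) :
  calG Q -> calG U ->
  assoc_poly (Q * U) m = \sum_(k < m.+1) Q m k *: assoc_poly U k.
Proof.
move=> GQ GU; have [Q0 _] := GQ; have [U0 _] := GU.
apply/polyP => j; rewrite coef_sum coef_poly.
(* For [j > m] the truncation in [\poly] is harmless, the product being lower triangular. *)
transitivity ((Q * U) m j).
  by case: ltnP => // mj; rewrite (calGM GQ GU).1.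
rewrite calG_mulE //; apply: eq_bigr => k _.
by rewrite coefZ coef_poly; case: ltnP => // kj; rewrite U0.
Qed.

Theorem corollary3p2 (R : realType) (P U : hessenberg R[i])
    (hP : monic_calG P) (hU : monic_calG U) :
  let p := assoc_poly P in
  let u := assoc_poly U in
  let H := P * shiftX R[i] * P^-1 in
  let K := U * shiftX R[i] * U^-1 in
  let e (n m k : nat) : R[i] :=
    \sum_(j < (n + m).+1) horner_alg H (p n) m j * horner_alg K (p j) 0%N k in
  forall m : nat,
    p m = \sum_(k < m.+1) e 0%N m k *: u k /\
    p m = \sum_(k < m.+1) horner_alg K (p m) 0%N k *: u k.
Proof.
move=> p u H K e m.
have [GP P1] := hP; have [GU U1] := hU; have [uU GV] := calG_unitV GU.
have pE : p m = \sum_(k < m.+1) horner_alg K (p m) 0%N k *: u k.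
  (* Factor $P = (PU^{-1})U$, so that row $m$ of $PU^{-1}$ holds the coordinates. *)
  rewrite {1}/p -[P](mulrVK uU) assoc_polyM //; last exact: calGM.
  by apply: eq_bigr => k _; rewrite horner_alg_conjX_row0.
have p0 : p 0%N = 1.
  by apply/polyP => j; rewrite coef_poly coef1; case: j => [|j] //=; rewrite P1.
(* As $p_0(H) = I$, only the last term $j = m$ of the sum survives. *)
have eE k : e 0%N m k = horner_alg K (p m) 0%N k.
  rewrite /e p0 rmorph1 big_ord_recr /= eqxx mul1r big1 ?add0r // => i _.
  by rewrite gtn_eqF ?mul0r.
by split=> //; rewrite {1}pE; apply: eq_bigr => k _; rewrite eE.
Qed.
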